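(* Let $p\ge 0$ be an integer and let $G$ be a minimal forbidden interval subgraph for the class of $p$-improper interval graphs, with basepoint $z$. Let $H$ be an unconfined, exterior side component of $G$. Then $H$ consists of precisely two vertices: an exterior vertex (a vertex at distance at least $2$ from $z$), and a vertex connecting it to the basepoint (a vertex adjacent both to the exterior vertex and to $z$).
   Context: All graphs are finite and simple. An interval graph is a graph $G=(V,E)$ having a representation $\alpha: v\mapsto I_v$ by intervals of the real line such that, for distinct $v,w$, $vw\in E$ if and only if $I_v\cap I_w\neq\emptyset$. $G$ is $p$-improper if it has a representation in which no interval properly contains more than $p$ other intervals. The impropriety $\mathrm{imp}(G)$ is the smallest $p$ such that $G$ is $p$-improper. A minimal forbidden interval subgraph for the class of $p$-improper interval graphs is an interval graph that is not $p$-improper but all of whose proper (induced) subgraphs are $p$-improper. A basepoint of $G$ is a vertex $z$ such that in every representation $I_z$ properly contains the intervals of at least $\mathrm{imp}(G)$ other vertices; ''the basepoint'' denotes this vertex $z$. The local components of $G$ are the connected components of $G\setminus\{z\}$; the support of a local component is the union of the intervals of its vertices. Given a representation, order the local components $H_0,\dots,H_m$ by their supports from left to right; $H_0$ and $H_m$ are the side components. A potential side component is a local component that is a side component in some representation. A vertex contributes to the impropriety of $G$ in a representation if its interval is properly contained in $I_z$. A side component is exterior if it contains at least one vertex at distance at least $2$ from $z$ (such a vertex is called an exterior vertex), and non-exterior otherwise. A potential side component $H$ is unconfined if there is a representation of $G$ in which $H$ contains no vertex that contributes to the impropriety of $G$; it is confined if in every representation it contains at least one such vertex. *)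

(* Defs.v *)
From HB Require Import structures.
From mathcomp Require Import all_boot all_order all_algebra.
From mathcomp Require Import all_classical all_reals all_analysis.
Set Implicit Arguments.
Unset Strict Implicit.
Unset Printing Implicit Defensive.
Import Order.TTheory GRing.Theory Num.Theory.
Local Open Scope classical_set_scope.
Local Open Scope ring_scope.

(* A finite simple graph is a finType T with a symmetric, irreflexive e : rel T. *)

Definition induced (T : finType) (e : rel T) (A : {set T}) :
  rel {x : T | x \in A} := relpre val e.

Section Representations.
Variables (R : realType) (T : finType).
Implicit Types (e : rel T) (alpha : T -> set R) (z : T) (H : {set T}).

(* Intervals may be open, closed, half-open, degenerate or unbounded, but not
   empty. *)
Definition representation e alpha : Prop :=
  [/\ forall v, is_interval (alpha v),
      forall v, alpha v !=set0 &
      forall v w, v != w -> (e v w <-> alpha v `&` alpha w !=set0)].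

Definition interval_graph e : Prop := exists alpha, representation e alpha.

(* The vertices whose interval is properly contained in that of v, as sets;
   counting vertices, vertices with equal intervals count separately. *)
Definition contained alpha v : {set T} :=
  finset (fun w => `[< alpha w `<` alpha v >]).

Definition p_improper e (p : nat) : Prop :=
  exists2 alpha, representation e alpha &
    forall v, (#|contained alpha v| <= p)%N.

Lemma interval_graph_p_improper e :
  interval_graph e -> exists p, `[< p_improper e p >].
Proof.
by move=> [alpha ha]; exists #|T|; apply/asboolP; exists alpha => // v;
  exact: max_card.
Qed.

(* The value 0 off interval graphs is a junk value. *)
Definition imp e : nat :=
  if pselect (exists p, `[< p_improper e p >]) is left ex_p
  then ex_minn ex_p else 0%N.

Lemma impP e : interval_graph e ->
  p_improper e (imp e) /\ forall p, p_improper e p -> (imp e <= p)%N.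
Proof.
move=> /interval_graph_p_improper exp; rewrite /imp.
case: pselect => // ex_p; case: ex_minnP => m /asboolP hm minm.
by split=> // p hp; apply: minm; apply/asboolP.
Qed.

Definition basepoint e z : Prop :=
  forall alpha, representation e alpha -> (imp e <= #|contained alpha z|)%N.

Definition local_components e z : {set {set T}} :=
  equivalence_partition
    (connect [rel x y | [&& x != z, y != z & e x y]]) (finset (predC1 z)).

Definition support alpha H : set R := \bigcup_(v in [set` H]) alpha v.

Definition left_of alpha H K : Prop :=
  forall x y, support alpha H x -> support alpha K y -> x < y.

(* H is the first or the last local component from left to right. *)
Definition side_component e z alpha H : Prop :=
  H \in local_components e z /\
  ((forall K, K \in local_components e z -> K != H -> left_of alpha H K) \/
   (forall K, K \in local_components e z -> K != H -> left_of alpha K H)).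

Definition potential_side_component e z H : Prop :=
  exists2 alpha, representation e alpha & side_component e z alpha H.

Definition contributes alpha z v : Prop := alpha v `<` alpha z.

Definition unconfined e z H : Prop :=
  potential_side_component e z H /\
  exists2 alpha, representation e alpha &
    forall v, v \in H -> ~ contributes alpha z v.

End Representations.

Definition minimal_forbidden (R : realType) (T : finType) (e : rel T)
    (p : nat) : Prop :=
  [/\ interval_graph R e, ~ p_improper R e p &
      forall A : {set T}, A \proper [set: T]%SET ->
        p_improper R (@induced T e A) p].

(* The distance from x to y, i.e. the least length of a walk from x to y
   (infinite when there is none), is at least k. *)
Definition dist_ge (T : finType) (e : rel T) (k : nat) (x y : T) : Prop :=
  forall s : seq T, path e x s -> last x s = y -> (k <= size s)%N.

Definition exterior_vertex (T : finType) (e : rel T) (z v : T) : Prop :=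
  dist_ge e 2 z v.

Definition exterior (T : finType) (e : rel T) (z : T) (H : {set T}) : Prop :=
  exists2 v, v \in H & exterior_vertex e z v.

(* Main.v *)
(** Let [alpha] represent the graph with no vertex of [H] contributing, and
    choose adjacent [x], [y] in [H] with [y] adjacent to [z] and [x] not. If [H]
    had a third vertex, then [G] without [H :\: [set x; y]] would have a
    representation [beta] in which at most [p] intervals lie properly in that of
    [z]. In [beta], the interval of [y] sticks out of that of [z] at one end,
    away from all other components; in [alpha], every neighbour of [z] in [H]
    sticks out of the interval of [z] at the same end, and the other vertices of
    [H] lie beyond that end. So one may cut [beta] inside [y] and [z], cut [alpha]
    at a common point of [z] and of its neighbours in [H], and glue the [beta]-part
    of [G - H] to the [alpha]-part of [H]. Nothing in [H] contributes in the glued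
    representation, hence at most [p] vertices do, against [z] being a
    basepoint. *)
Require Import Defs.
From mathcomp Require Import all_boot all_order all_algebra.
From mathcomp Require Import all_classical all_reals all_analysis.
Set Implicit Arguments.
Unset Strict Implicit.
Import Order.TTheory GRing.Theory Num.Theory.
Local Open Scope classical_set_scope.
Local Open Scope ring_scope.

(** * Representations on a set of vertices, and reflection of the line *)

Section Representations.
Context {R : realType} {T : finType}.
Implicit Types (e : rel T) (alpha beta : T -> set R) (A C H : {set T}).

(** Here [alpha] is total on [T] with arbitrary values off [A], so that representations of induced
    subgraphs and of the whole graph can be glued without subtypes. *)
Definition rep_on e A alpha : Prop :=
  [/\ forall v, v \in A -> is_interval (alpha v),
      forall v, v \in A -> alpha v !=set0 &
      forall v w, v \in A -> w \in A -> v != w ->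
        (e v w <-> alpha v `&` alpha w !=set0)].

Definition mirror alpha : T -> set R := fun v => [set t | alpha v (- t)].

Lemma rep_on_mirror e A alpha : rep_on e A alpha -> rep_on e A (mirror alpha).
Proof.
move=> [itv n0 adj]; split.
- move=> v vA s t /= hs ht u /andP[su ut].
  by apply: (itv v vA _ _ ht hs); rewrite !lerN2 ut su.
- by move=> v /n0[t ht]; exists (- t); rewrite /mirror /= opprK.
- move=> v w vA wA vw; rewrite adj //; split.
  + by move=> [t [tv tw]]; exists (- t); split; rewrite /mirror /= opprK.
  + by move=> [t [tv tw]]; exists (- t).
Qed.

Lemma mirror_subset alpha v w :
  mirror alpha v `<=` mirror alpha w <-> alpha v `<=` alpha w.
Proof.
split=> sub t ht; last exact: sub.
by have := sub (- t); rewrite /mirror /= opprK; apply.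
Qed.

Lemma mirror_proper alpha v w :
  mirror alpha v `<` mirror alpha w <-> alpha v `<` alpha w.
Proof. by rewrite /proper !mirror_subset. Qed.

Lemma representation_rep_on e alpha :
  representation e alpha -> rep_on e [set: T]%SET alpha.
Proof. by move=> [itv n0 adj]; split=> [v _|v _|v w _ _]; auto. Qed.

(** If [t <= s], then either [a] lies between [t] and [b], hence in [J], or [t] lies between [a] and
    [s], hence in [I]. *)
Lemma interval_disjoint_lt (I J : set R) : is_interval I -> is_interval J ->
  I `&` J = set0 -> forall a b, I a -> J b -> a < b ->
  forall s t, I s -> J t -> s < t.
Proof.
move=> itvI itvJ IJ0 a b Ia Jb ab s t Is Jt; rewrite ltNge; apply/negP => ts.
suff [u IJu] : (I `&` J) !=set0 by rewrite IJ0 in IJu.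
have [ta|at_] := lerP t a.
  by exists a; split=> //; apply: (itvJ t b) => //; rewrite ta ltW.
by exists t; split=> //; apply: (itvI a s) => //; rewrite ts ltW.
Qed.

Lemma rep_on_disjoint e A alpha v w : rep_on e A alpha ->
  v \in A -> w \in A -> v != w -> ~~ e v w -> alpha v `&` alpha w = set0.
Proof.
move=> [_ _ adj] vA wA vw /negP evw; apply/seteqP; split=> // t tvw.
by apply: evw; apply/(adj v w) => //; exists t.
Qed.

(** * Consequences of minimality *)

(** This is minimality for the subgraph induced by [A], transported from the subtype to [T] with
    value [set0] off [A]; of the bounds only the one at [z] is kept. *)
Lemma minimal_forbidden_rep_on e p A z :
  minimal_forbidden R e p -> A \proper [set: T]%SET -> z \in A ->
  exists2 beta, rep_on e A beta &
    forall B : {set T}, (forall v, v \in B -> v \in A /\ beta v `<` beta z) ->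
      (#|B| <= p)%N.
Proof.
move=> [_ _ sub] /sub[b [itv n0 adj] bp] zA.
pose beta v := if insub v is Some u then b u else set0.
have betaE v (vA : v \in A) : beta v = b (Sub v vA) by rewrite /beta insubT.
exists beta.
  split=> [v vA|v vA|v w vA wA vw]; rewrite !betaE //.
  by rewrite -adj.
move=> B BA; apply: leq_trans (bp (Sub z zA)).
rewrite -(card_imset _ val_inj); apply/subset_leq_card/fintype.subsetP => v vB.
have [vA] := BA v vB; rewrite !betaE => lt_vz.
by apply/imsetP; exists (Sub v vA) => //; rewrite inE; apply/asboolP.
Qed.

(** The impropriety is attained by some representation, so [imp e <= p] would make the graph
    [p]-improper. *)
Lemma basepoint_contributors e p z alpha : minimal_forbidden R e p ->
  basepoint R e z -> representation e alpha -> (p < #|contained alpha z|)%N.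
Proof.
move=> [itv nimp _] zb /zb; apply: leq_trans; rewrite ltnNge; apply/negP => le_p.
have [[g rg hg] _] := impP itv; apply: nimp; exists g => // v.
exact: leq_trans (hg v) le_p.
Qed.

(** A nonempty [C] could be deleted by minimality and reinserted on a half-line away from all other
    intervals. Nothing new would lie inside [z], leaving at most [p] contributors. *)
Lemma minimal_forbidden_connected e p z C : symmetric e ->
  minimal_forbidden R e p -> basepoint R e z -> z \notin C ->
  (forall v w, v \in C -> w \notin C -> ~~ e v w) -> C = finset.set0.
Proof.
move=> e_sym G_min z_base zC sep; apply/eqP/negPn/negP => C0.
have prC : ~: C \proper [set: T]%SET.
  rewrite finset.properT; apply: contra C0 => /eqP CT.
  by rewrite -(finset.setCK C) CT finset.setCT.
have zC' : z \in ~: C by rewrite finset.in_setC.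
have [beta [bitv bn0 badj] bp] := minimal_forbidden_rep_on G_min prC zC'.
have [[alpha [aitv an0 aadj]] _ _] := G_min.
(* [expR] and its mirror image squeeze the two parts into the two open half-lines. *)
pose gamma v : set R := if v \in C then [set t | 0 < t /\ alpha v (ln t)]
  else [set t | t < 0 /\ beta v (- ln (- t))].
have gammaC v : v \in C -> gamma v = [set t | 0 < t /\ alpha v (ln t)].
  by rewrite /gamma => ->.
have gammaN v : v \notin C -> gamma v = [set t | t < 0 /\ beta v (- ln (- t))].
  by rewrite /gamma => /negPf ->.
have alphaE v t : v \in C -> alpha v t -> gamma v (expR t).
  by move=> vC vt; rewrite gammaC //=; split; rewrite ?expR_gt0 ?expRK.
have betaE v t : v \notin C -> beta v t -> gamma v (- expR (- t)).
  by move=> vC vt; rewrite gammaN //=; split; rewrite ?oppr_lt0 ?expR_gt0 ?opprK ?expRK ?opprK.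
have gamma_rep : representation e gamma.
  split.
  - move=> v; have [vC|vC] := boolP (v \in C).
      rewrite gammaC // => s t [s0 vs] [t0 vt] u /andP[su ut].
      have u0 : 0 < u by apply: lt_le_trans su.
      by split=> //; apply: (aitv v _ _ vs vt); rewrite !ler_ln ?posrE // su.
    rewrite gammaN // => s t [s0 vs] [t0 vt] u /andP[su ut].
    have u0 : u < 0 by apply: le_lt_trans t0.
    split=> //; apply: (bitv v _ _ _ vs vt); first by rewrite finset.in_setC.
    by rewrite !lerN2 !ler_ln ?posrE ?oppr_gt0 // !lerN2 su.
  - move=> v; have [vC|vC] := boolP (v \in C).
      by have [t vt] := an0 v; exists (expR t); exact: alphaE.
    have [|t vt] := bn0 v; first by rewrite finset.in_setC.
    by exists (- expR (- t)); exact: betaE.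
  - move=> v w vw; have [vC|vC] := boolP (v \in C); have [wC|wC] := boolP (w \in C).
    + rewrite aadj //; split=> [[t [vt wt]]|[t []]].
        by exists (expR t); split; exact: alphaE.
      by rewrite !gammaC // => -[_ vt] [_ wt]; exists (ln t).
    + split=> [evw|[t []]]; first by have := sep v w vC wC; rewrite evw.
      by rewrite (gammaC v vC) (gammaN w wC) => -[t0 _] [/(lt_trans t0)]; rewrite ltxx.
    + split=> [evw|[t []]]; first by have := sep w v wC vC; rewrite e_sym evw.
      by rewrite (gammaN v vC) (gammaC w wC) => -[t0 _] [t0' _]; have := lt_trans t0 t0'; rewrite ltxx.
    + rewrite badj ?finset.in_setC //; split=> [[t [vt wt]]|[t []]].
        by exists (- expR (- t)); split; exact: betaE.
      by rewrite !gammaN // => -[_ vt] [_ wt]; exists (- ln (- t)).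
suff : (#|contained gamma z| <= p)%N.
  by rewrite leqNgt (basepoint_contributors G_min z_base gamma_rep).
apply: bp => v; rewrite inE => /asboolP[sub nsub].
have [vC|vC] := boolP (v \in C).
  have [t vt] := an0 v; have := sub _ (alphaE _ _ vC vt).
  by rewrite (gammaN z zC) => -[/(lt_trans (expR_gt0 t))]; rewrite ltxx.
split; first by rewrite finset.in_setC.
split=> [t vt|zv].
  have := sub _ (betaE _ _ vC vt).
  by rewrite gammaN //= => -[_]; rewrite opprK expRK opprK.
by apply: nsub => t; rewrite !gammaN //= => -[t0 /zv].
Qed.

(** * Gluing two representations at a cut point *)

(** With [c] and [d] moved to 0, the two halves meet only at 0. There [z] is the only interval from
    outside [H], and it meets exactly its neighbours in [H]. Every interval of [H] reaches past 0,
    where [z] ends, so none contributes. *)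
Lemma glue e A H z alpha beta c d : symmetric e ->
  z \notin H -> ~: H \subset A -> rep_on e A beta -> representation e alpha ->
  (forall h v, h \in H -> v \notin H -> v != z -> ~~ e h v) ->
  beta z c -> (forall v t, v \notin H -> v != z -> beta v t -> t < c) ->
  alpha z d ->
  (forall h, h \in H -> e z h -> alpha h d /\ exists2 t, d < t & alpha h t) ->
  (forall h t, h \in H -> ~~ e z h -> alpha h t -> d < t) ->
  exists2 gamma : T -> set R, representation e gamma &
    forall v, gamma v `<` gamma z -> v \in A /\ beta v `<` beta z.
Proof.
move=> e_sym zH /fintype.subsetP HA [bitv bn0 badj] [aitv an0 aadj].
move=> sep zc bc zd adj nadj.
have inA v : v \notin H -> v \in A by move=> vH; apply: HA; rewrite finset.in_setC.
have neH h : h \in H -> h != z by apply: contraTneq => ->.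
have left_d h t : h \in H -> alpha h t -> t <= d -> e z h.
  move=> hH ht td; apply/negPn/negP => /(nadj h t hH)/(_ ht).
  by rewrite ltNge td.
pose gamma v : set R := if v \in H then [set t | 0 <= t /\ alpha v (t + d)]
  else [set t | t <= 0 /\ beta v (t + c)].
have gammaH v : v \in H -> gamma v = [set t | 0 <= t /\ alpha v (t + d)].
  by rewrite /gamma => ->.
have gammaN v : v \notin H -> gamma v = [set t | t <= 0 /\ beta v (t + c)].
  by rewrite /gamma => /negPf ->.
have betaE v t : v \notin H -> v != z -> beta v t -> gamma v (t - c).
  by move=> vH vz vt; rewrite gammaN //= subrK subr_le0 ltW ?(bc v).
have pos h : h \in H -> exists2 t, 0 < t & gamma h t.
  move=> hH; rewrite gammaH //; suff [t dt ht] : exists2 t, d < t & alpha h t.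
    by exists (t - d); rewrite /= ?subr_gt0 ?subrK // subr_ge0 ltW.
  have [/adj[]//|/nadj nzh] := boolP (e z h).
  by have [t ht] := an0 h; exists t => //; exact: nzh ht.
have zh_adj h : h \in H -> e z h <-> gamma z `&` gamma h !=set0.
  move=> hH; rewrite gammaN // gammaH //; split=> [/adj[]// hd _|[t []]].
    by exists 0; split; rewrite /= add0r.
  move=> /= [t0 _] [t0' ht]; apply: left_d ht _ => //.
  by rewrite ler_wnDl.
have hv_sep h v : h \in H -> v \notin H -> v != z ->
    e h v <-> gamma h `&` gamma v !=set0.
  move=> hH vH vz; split=> [ehv|[t []]].
    by have := sep h v hH vH vz; rewrite ehv.
  rewrite gammaH // gammaN // => -[t0 _] [_ /bc]/(_ vH vz).
  by rewrite ltNge lerDr t0.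
have zv_adj v : v \notin H -> v != z -> e z v <-> gamma z `&` gamma v !=set0.
  move=> vH vz; rewrite badj ?inA 1?eq_sym //; split=> [[t [zt vt]]|[t []]].
    exists (t - c); split; last exact: betaE.
    by rewrite gammaN //= subrK subr_le0 ltW ?(bc v).
  by rewrite !gammaN // => -[_ zt] [_ vt]; exists (t + c).
exists gamma; first split.
- move=> v; have [vH|vH] := boolP (v \in H).
    rewrite gammaH // => s t [s0 vs] [t0 vt] u /andP[su ut].
    split; first exact: le_trans su.
    by apply: (aitv v _ _ vs vt); rewrite !lerD2r su.
  rewrite gammaN // => s t [s0 vs] [t0 vt] u /andP[su ut].
  split; first exact: le_trans t0.
  by apply: (bitv v (inA v vH) _ _ vs vt); rewrite !lerD2r su.
- move=> v; have [/pos[t _ ht]|vH] := boolP (v \in H); first by exists t.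
  have [->|vz] := eqVneq v z; first by exists 0; rewrite gammaN //= add0r.
  by have [t vt] := bn0 v (inA v vH); exists (t - c); exact: betaE.
- move=> v w; have [->|vz] := eqVneq v z.
    by rewrite eq_sym => wz; have [/zh_adj//|wH] := boolP (w \in H); exact: zv_adj.
  have [-> _|wz vw] := eqVneq w z.
    rewrite e_sym setIC.
    by have [/zh_adj//|vH] := boolP (v \in H); exact: zv_adj.
  have [vH|vH] := boolP (v \in H); have [wH|wH] := boolP (w \in H).
  + rewrite !gammaH //; split=> [evw|[t [[_ vt] [_ wt]]]]; last first.
      by apply/(aadj v w) => //; exists (t + d).
    have /(aadj v w vw)[t [vt wt]] := evw.
    have [dt|td] := leP d t.
      by exists (t - d); rewrite /= subrK subr_ge0.
    (* A common point lost by the cut lies left of [d]; then both vertices are neighbours of [z] and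
       share [d] itself. *)
    exists 0; rewrite /= add0r lexx.
    have [vd _] := adj v vH (left_d v t vH vt (ltW td)).
    by have [wd _] := adj w wH (left_d w t wH wt (ltW td)).
  + exact: hv_sep.
  + by rewrite e_sym setIC; exact: hv_sep.
  + rewrite badj ?inA //; split=> [[t [vt wt]]|[t []]].
      by exists (t - c); split; exact: betaE.
    by rewrite !gammaN // => -[_ vt] [_ wt]; exists (t + c).
- move=> v [sub nsub]; have [/pos[t t0 /sub]|vH] := boolP (v \in H).
    by rewrite gammaN // => -[]; rewrite leNgt t0.
  split; first exact: inA.
  have [vz|vz] := eqVneq v z; first by case: nsub; rewrite vz.
  (* The containment in [beta] is proper because [c] lies in [z] but not in [v]. *)
  split=> [t vt|/(_ c zc)/bc]; last by rewrite ltxx => /(_ vH vz).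
  by have := sub _ (betaE v t vH vz vt); rewrite gammaN //= subrK => -[].
Qed.

(** * Local components and the end at which they stick out *)

(** Connectedness is given as an induction principle: a property passed along edges inside [H]
    spreads from one vertex to all. *)
Lemma local_componentP e z H : symmetric e -> H \in local_components e z ->
  [/\ z \notin H,
      forall h v, h \in H -> v \notin H -> v != z -> ~~ e h v &
      forall P : T -> Prop,
        (forall v w, v \in H -> w \in H -> e v w -> P v -> P w) ->
        forall a b, a \in H -> b \in H -> P a -> P b].
Proof.
move=> e_sym; set r := [rel x y | [&& x != z, y != z & e x y]].
have r_sym : connect_sym r.
  by apply: sym_connect_sym => a b /=; rewrite e_sym andbCA.
move=> /imsetP[x]; rewrite inE /= => xz ->; split.
- by rewrite !inE eqxx.
- move=> h v; rewrite !inE => /andP[hz xh] + vz; rewrite vz /=; apply: contra => ehv.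
  by apply: connect_trans xh (connect1 _); rewrite /= hz vz.
- move=> P step a b; rewrite !inE => /andP[az xa] /andP[bz xb] Pa.
  have /connectP[s sp ->] : connect r a b.
    by apply: connect_trans xb; rewrite r_sym.
  elim: s a az xa Pa sp => //= w s IH a az xa Pa /andP[/and3P[_ wz eaw] sp].
  have xw : connect r x w by apply: connect_trans xa (connect1 _); rewrite /= az wz.
  by apply: IH => //; apply: step eaw Pa; rewrite !inE ?az ?wz.
Qed.

(** Some contributor [v] exists, necessarily outside [H]. Being connected and not adjacent to [v],
    all of [H] lies on one side of [v], on the right after a reflection; there its noncontributing
    neighbours of [z] must leave [z]. *)
Lemma noncontributing_end e p z H alpha y :
  minimal_forbidden R e p -> basepoint R e z ->
  z \notin H -> (forall h v, h \in H -> v \notin H -> v != z -> ~~ e h v) ->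
  (forall P : T -> Prop,
    (forall v w, v \in H -> w \in H -> e v w -> P v -> P w) ->
    forall a b, a \in H -> b \in H -> P a -> P b) ->
  representation e alpha -> (forall v, v \in H -> ~ alpha v `<` alpha z) ->
  y \in H -> e z y ->
  exists (alpha' : T -> set R) d, [/\ representation e alpha', alpha' z d,
    forall h, h \in H -> e z h -> alpha' h d /\ exists2 t, d < t & alpha' h t &
    forall h t, h \in H -> ~~ e z h -> alpha' h t -> d < t].
Proof.
move=> G_min z_base zH sep conn.
move=> a_rep ncontr yH ezy.
have /card_gt0P[v] : (0 < #|contained alpha z|)%N.
  exact: leq_ltn_trans (basepoint_contributors G_min z_base a_rep).
rewrite inE => /asboolP vz; have [_ /(_ v)[b vb] _] := a_rep.
have vH : v \notin H by apply/negP => /ncontr.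
have zv : v != z by apply/eqP => vEz; move: vz; rewrite vEz => -[].
have zb : alpha z b by apply: vz.1.
have [s ys] : alpha y !=set0 by have [_ /(_ y)] := a_rep.
wlog bs : alpha a_rep ncontr vz b s vb zb ys / b < s.
  have [bs|sb|sb] := ltgtP b s; first by apply; eauto.
    move=> W; apply: (W (mirror alpha) _ _ _ (- b) (- s)) => //.
    - have [itv n0 adj] := rep_on_mirror (representation_rep_on a_rep).
      by split=> [w|w|w w' ww']; [apply: itv|apply: n0|apply: adj].
    - by move=> w /ncontr; rewrite mirror_proper.
    - by rewrite mirror_proper.
    - by rewrite /mirror /= opprK.
    - by rewrite /mirror /= opprK.
    - by rewrite /mirror /= opprK.
    - by rewrite ltrN2.
  have [_ _ adj] := a_rep; have yv : y != v by apply: contraNneq vH => <-.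
  suff : e y v by rewrite (negPf (sep y v yH vH zv)).
  by apply/adj => //; exists s; split; rewrite // -sb.
have [itv n0 adj] := a_rep.
have repT := representation_rep_on a_rep.
have dis h : h \in H -> alpha h `&` alpha v = set0.
  move=> hH; apply: (rep_on_disjoint repT); rewrite ?inE //.
    by apply: contraNneq vH => <-.
  exact: sep.
have right_b1 h s' t : h \in H -> alpha h s' -> b < s' -> alpha h t -> b < t.
  move=> hH hs' bs' ht; rewrite ltNge; apply/negP => tb.
  suff : (alpha h `&` alpha v) b by rewrite dis.
  by split=> //; apply: (itv h t s') => //; rewrite tb ltW.
have right_b h t : h \in H -> alpha h t -> b < t.
  move=> hH; move: t.
  apply: (conn (fun h => forall t, alpha h t -> b < t) _ y h) => //.
    move=> h1 h2 h1H h2H e12 bh1 t2 ht2.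
    have [h12|h12] := eqVneq h1 h2; first by apply: bh1; rewrite h12.
    have /(adj h1 h2 h12)[u [/bh1 bu h2u]] := e12.
    exact: right_b1 h2u bu ht2.
  by move=> t; exact: right_b1 ys bs.
(* Since [z] contains [b], it can only be left to the right. *)
have beyond t u : b < t -> ~ alpha z t -> alpha z u -> u < t.
  move=> bt nzt zu; rewrite ltNge; apply/negP => tu; apply: nzt.
  by apply: (itv z b u) => //; rewrite tu ltW.
have neH h : h \in H -> z != h by move=> hH; apply: contraNneq zH => ->.
(* Take [d] as the maximum of [b] and one common point with [z] for each neighbour of [z] in [H]. *)
have [d zd dK] : exists2 d, alpha z d &
    forall h, h \in H -> e z h -> exists2 u, u <= d & alpha h u.
  suff [d zd dK] : exists2 d, alpha z d & forall h, h \in enum H -> h \in H ->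
      e z h -> exists2 u, u <= d & alpha h u.
    by exists d => // h hH; apply: dK; rewrite ?mem_enum.
  elim: (enum H) => [|k r [d zd dK]]; first by exists b.
  have [/andP[kH ezk]|nk] := boolP ((k \in H) && e z k); last first.
    exists d => // h; rewrite inE => /orP[/eqP->|]; last exact: dK.
    by move=> kH ezk; rewrite kH ezk in nk.
  have /(adj z k (neH k kH))[u [zu ku]] := ezk.
  exists (Num.max d u); first by rewrite maxEle; case: ifP.
  move=> h; rewrite inE => /orP[/eqP-> _ _|hr hH ezh].
    by exists u; rewrite // le_max lexx orbT.
  by have [u' u'd hu'] := dK h hr hH ezh; exists u'; rewrite // le_max u'd.
exists alpha, d; split=> // [h hH ezh|h t hH nezh ht]; last first.
  apply: beyond zd; first exact: right_b ht.
  by move=> zt; apply: (negP nezh); apply/(adj z h (neH h hH)); exists t.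
(* Otherwise [h] would lie inside [z], and properly so, since [h] misses [b]. *)
have [t ht nzt] : exists2 t, alpha h t & ~ alpha z t.
  apply: contrapT => nt; apply: (ncontr h hH); split=> [t ht|/(_ b zb) hb].
    by apply: contrapT => nzt; apply: nt; exists t.
  by have := right_b h b hH hb; rewrite ltxx.
have dt : d < t by apply: beyond zd => //; exact: right_b ht.
split; last by exists t.
have [u ud hu] := dK h hH ezh.
by apply: (itv h u t) => //; rewrite ud ltW.
Qed.

End Representations.

(** * Excluding a third vertex *)

Theorem theorem5 (R : realType) (T : finType) (e : rel T)
    (e_sym : symmetric e) (e_irr : irreflexive e) (p : nat)
    (G_min : minimal_forbidden R e p)
    (z : T) (z_base : basepoint R e z)
    (H : {set T}) (H_side : potential_side_component R e z H)
    (H_unconf : unconfined R e z H) (H_ext : exterior e z H) :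
  exists x y : T,
    [/\ H = [set x; y]%SET, x != y, exterior_vertex e z x, e y x & e y z].
Proof.
have [[_ _ [Hloc _]] [alpha a_rep ncontr]] := H_unconf.
have [zH sep conn] := local_componentP e_sym Hloc.
have neH h : h \in H -> h != z by apply: contraTneq => ->.
have [x0 x0H x0_ext] := H_ext.
have nezx0 : ~~ e z x0.
  apply/negP => ezx0; have := x0_ext [:: x0] => /=.
  by rewrite ezx0 => /(_ isT erefl).
have [y0 y0H ezy0] : exists2 y, y \in H & e z y.
  apply: contrapT => ny; suff H0 : H = finset.set0 by rewrite H0 inE in x0H.
  apply: (minimal_forbidden_connected e_sym G_min z_base zH) => h v hH vH.
  have [->|] := eqVneq v z; last exact: sep.
  by apply/negP => ehz; apply: ny; exists h; rewrite // e_sym.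
(* Without such an edge, adjacency to [z] would spread from [y0] through [H] to [x0]. *)
have [y [x [yH xH eyx ezy nezx]]] :
    exists y x, [/\ y \in H, x \in H, e y x, e z y & ~~ e z x].
  apply: contrapT => nyx; apply: (negP nezx0).
  apply: (conn (fun h => e z h) _ y0 x0) => // v w vH wH evw ezv.
  by apply: contrapT => /negP nezw; apply: nyx; exists v, w.
have xy : x != y by apply: contraNneq nezx => ->.
have x_ext : exterior_vertex e z x.
  case=> [_ /= zx|v [|//] /= /andP[ezv _] vx]; first by rewrite -zx (negPf zH) in xH.
  by rewrite -vx ezv in nezx.
exists x, y; split=> //; last by rewrite e_sym.
(* A third vertex of [H] is missing from [A], so minimality applies to [A]. *)
apply: contrapT => Hxy; pose A := ~: (H :\: [set x; y]%SET).
have prA : A \proper [set: T]%SET.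
  rewrite finset.properT; apply/eqP => AT; apply: Hxy; apply/setP => h.
  have : h \in A by rewrite AT inE.
  rewrite !inE negb_and negbK => /orP[hxy|/negPf hH].
    by rewrite hxy; case/orP: hxy => /eqP->.
  by rewrite hH; apply/esym/negP => /orP[] /eqP hE; rewrite hE ?xH ?yH in hH.
have NHA v : v \notin H -> v \in A by rewrite !inE => /negPf->; rewrite andbF.
have xA : x \in A by rewrite !inE eqxx.
have yA : y \in A by rewrite !inE eqxx orbT.
have zA := NHA z zH.
have [beta b_rep bp] := minimal_forbidden_rep_on G_min prA zA.
have [zx zy] : z != x /\ z != y by rewrite !(eq_sym z) !neH.
have [_ n0 _] := b_rep.
have [u zu] := n0 z zA; have [t xt] := n0 x xA.
(* The disjoint intervals of [z] and [x] are ordered; a reflection puts [x] on the right. *)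
wlog ut : beta b_rep bp n0 u t zu xt / u < t.
  have [ut|tu|ut] := ltgtP u t; first by apply; eauto.
    move=> W; have mb_rep := rep_on_mirror b_rep; have [_ mn0 _] := mb_rep.
    apply: (W (mirror beta) mb_rep _ mn0 (- u) (- t)) => //.
    - by move=> B BA; apply: bp => v /BA; rewrite mirror_proper.
    - by rewrite /mirror /= opprK.
    - by rewrite /mirror /= opprK.
    - by rewrite ltrN2.
  have := rep_on_disjoint b_rep zA xA zx nezx; rewrite -ut in xt.
  by move=> /seteqP[/(_ u)]; case.
have [itv _ adj] := b_rep.
have zx_lt : forall s s', beta z s -> beta x s' -> s < s'.
  apply: interval_disjoint_lt zu xt ut; [exact: itv|exact: itv|].
  exact: rep_on_disjoint b_rep _ _ _ _.
(* The interval of [y] runs from [c] in [z] to [s] in [x], hence past the right end of [z]. *)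
have /(adj z y zA yA zy)[c [zc yc]] := ezy.
have /(adj y x yA xA)[|s [ys xs]] := eyx; first by rewrite eq_sym.
have y_sep v w : v \notin H -> v != z -> w \in [set x; y]%SET -> beta w `&` beta v = set0.
  move=> vH vz wxy; have [wH wA] : w \in H /\ w \in A.
    by move: wxy; rewrite !inE => /orP[]/eqP->; rewrite eqxx ?orbT.
  apply: rep_on_disjoint b_rep _ _ _ _ => //; first exact: NHA.
    by apply: contraNneq vH => <-.
  exact: sep.
have yv_lt v a b : v \notin H -> v != z -> beta y a -> beta v b -> a < b ->
    forall a' b', beta y a' -> beta v b' -> a' < b'.
  move=> vH vz ya vb ab; apply: interval_disjoint_lt ya vb ab.
  - exact: itv.
  - by apply: itv; exact: NHA.
  - by apply: y_sep => //; rewrite !inE eqxx orbT.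
(* Vertices outside [H] that reach past [c] miss [y], so they lie entirely to its right, beyond [z].
   They are thus cut off from the rest of the graph, and [C] is empty. *)
pose C := [set v | [&& v \notin H, v != z & `[< exists2 b, beta v b & c < b >]]]%SET.
have CP v : v \in C -> [/\ v \notin H, v != z &
    forall a b, beta y a -> beta v b -> a < b].
  rewrite inE => /and3P[vH vz /asboolP[b vb cb]]; split=> //.
  exact: yv_lt yc vb cb.
have C0 : C = finset.set0.
  apply: (minimal_forbidden_connected e_sym G_min z_base (z := z)).
    by rewrite inE eqxx andbF.
  move=> v w /CP[vH vz v_right] wC.
  have [wH|wH] := boolP (w \in H); first by rewrite e_sym; exact: sep.
  apply/negP => evw; have [vw|vw] := eqVneq v w; first by rewrite vw e_irr in evw.
  have /(adj v w (NHA v vH) (NHA w wH) vw)[b [vb wb]] := evw.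
  have [wz|wz] := eqVneq w z.
    rewrite wz in wb; have := v_right _ _ ys vb.
    by rewrite ltNge ltW // zx_lt.
  move/negP: wC; apply; rewrite inE wH wz; apply/asboolP; exists b => //.
  exact: v_right.
have left_c v b : v \notin H -> v != z -> beta v b -> b < c.
  move=> vH vz vb; have [//|cb|bc] := ltgtP b c.
    suff : v \in C by rewrite C0 inE.
    by rewrite inE vH vz; apply/asboolP; exists b.
  suff : (beta y `&` beta v) c by rewrite y_sep // !inE eqxx orbT.
  by split=> //; rewrite -bc.
have [alpha' [d [a'_rep zd adjH nadjH]]] :=
  noncontributing_end G_min z_base zH sep conn a_rep ncontr yH ezy.
have HA : ~: H \subset A by apply/fintype.subsetP => v; rewrite finset.in_setC; exact: NHA.
have [gamma g_rep g_contr] :=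
  glue e_sym zH HA b_rep a'_rep sep zc (fun v t => @left_c v t) zd adjH nadjH.
have := basepoint_contributors G_min z_base g_rep.
rewrite ltnNge; apply/negP/negPn; apply: bp => v.
by rewrite inE => /asboolP/g_contr.
Qed.
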